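(* Let $T\in\mathcal{B}_A(\mathcal{H})$. Then $$\omega_A^2(T)\le\inf_{\alpha,\beta}\frac{1}{\alpha+\beta}\Big\{\Big\|\big(\tfrac{\alpha}{4}+\beta\big)T^{\sharp_A}T+\tfrac{\alpha}{4}TT^{\sharp_A}\Big\|_A+\tfrac{\alpha}{2}\,\omega_A(T^2)\Big\},$$ where the infimum is over all reals $\alpha,\beta\ge0$ with $(\alpha,\beta)\ne(0,0)$.
   Context: $\mathcal{H}$ is a non-trivial complex Hilbert space, $\mathcal{B}(\mathcal{H})$ the bounded linear operators on it, $A\in\mathcal{B}(\mathcal{H})$ a fixed positive operator ($\langle Ax,x\rangle\ge0$ for all $x$). Put $\langle x,y\rangle_A=\langle Ax,y\rangle$ and $\|x\|_A=\langle Ax,x\rangle^{1/2}$. $\mathcal{B}_A(\mathcal{H})$ is the set of $T\in\mathcal{B}(\mathcal{H})$ for which there is $W\in\mathcal{B}(\mathcal{H})$ with $AW=T^*A$ (equivalently, $\mathcal{R}(T^*A)\subseteq\mathcal{R}(A)$); for such $T$, $T^{\sharp_A}=A^\dagger T^*A$ ($A^\dagger$ the Moore–Penrose inverse) is the unique bounded $W$ with $AW=T^*A$ and $\mathcal{R}(W)\subseteq\overline{\mathcal{R}(A)}$. Every $T\in\mathcal{B}_A(\mathcal{H})$ satisfies $\|Tx\|_A\le c\|x\|_A$ for all $x$, for some $c>0$; put $\|T\|_A=\sup_{\|x\|_A=1}\|Tx\|_A$ and $\omega_A(T)=\sup_{\|x\|_A=1}|\langle Tx,x\rangle_A|$. 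*)

(* Defs.v *)
From HB Require Import structures.
From mathcomp Require Import all_boot all_order all_algebra.
From mathcomp Require Export complex.
From mathcomp Require Import all_classical all_reals all_analysis.

Set Implicit Arguments.
Unset Strict Implicit.
Unset Printing Implicit Defensive.

Import Order.TTheory GRing.Theory Num.Theory Num.Def.
Import numFieldNormedType.Exports.

Local Open Scope classical_set_scope.
Local Open Scope ring_scope.
Local Open Scope complex_scope.

(* A complex Hilbert space is a Banach space over R[i] whose norm comes from
   an inner product; [dot] is linear in its first argument and conjugate-linear
   in the second. *)
Definition hilbert_norm (R : realType) (H : completeNormedModType R[i])
    (dot : {dot H for conjC}) : Prop :=
  forall x : H, `|x| ^+ 2 = dot x x.

Definition bounded_op (R : realType) (H : completeNormedModType R[i])
    (T : {linear H -> H}) : Prop :=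
  exists M : R, forall x : H, `|T x| <= M%:C * `|x|.

(* In R[i] the order relation [0 <= z] forces [z] to be real. *)
Definition positive_op (R : realType) (H : completeNormedModType R[i])
    (dot : {dot H for conjC}) (A : {linear H -> H}) : Prop :=
  forall x : H, 0 <= dot (A x) x.

(* Hilbert space adjoint: for a bounded linear [T], the vector characterized by
   <T x, y> = <x, T^* y> exists by the Riesz representation theorem and is
   unique; the default value 0 is then never used. *)
Definition adjoint_op (R : realType) (H : completeNormedModType R[i])
    (dot : {dot H for conjC}) (T : H -> H) (y : H) : H :=
  xget 0 [set z : H | forall x : H, dot (T x) y = dot x z].

Definition orthocompl (R : realType) (H : completeNormedModType R[i])
    (dot : {dot H for conjC}) (S : set H) : set H :=
  [set x | forall z, S z -> dot x z = 0].

(* Moore-Penrose inverse: the linear extension of the inverse of the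
   restriction A : N(A)^perp -> R(A) to R(A) + R(A)^perp, with kernel R(A)^perp.
   Thus A^dagger (A x + r) = x for x in N(A)^perp and r in R(A)^perp.
   Outside of its domain R(A) + R(A)^perp the value is 0 by convention. *)
Definition mp_inverse (R : realType) (H : completeNormedModType R[i])
    (dot : {dot H for conjC}) (A : H -> H) (y : H) : H :=
  xget 0 [set x : H | orthocompl dot (A @^-1` [set 0]) x /\
                      orthocompl dot (range A) (y - A x)].

Definition in_BA (R : realType) (H : completeNormedModType R[i])
    (dot : {dot H for conjC}) (A T : {linear H -> H}) : Prop :=
  bounded_op T /\
  exists W : {linear H -> H},
    bounded_op W /\ (A \o W = adjoint_op dot T \o A :> (H -> H)).

Definition sharp (R : realType) (H : completeNormedModType R[i])
    (dot : {dot H for conjC}) (A T : H -> H) : H -> H :=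
  mp_inverse dot A \o adjoint_op dot T \o A.

Definition dotA (R : realType) (H : completeNormedModType R[i])
    (dot : {dot H for conjC}) (A : H -> H) (x y : H) : R[i] :=
  dot (A x) y.

(* For positive [A] the number [dotA dot A x x] is real and nonnegative. *)
Definition seminormA (R : realType) (H : completeNormedModType R[i])
    (dot : {dot H for conjC}) (A : H -> H) (x : H) : R :=
  Num.sqrt (complex.Re (dotA dot A x x)).

(* In the two suprema below, [sup] is that of a set of real numbers, with
   [sup set0 = 0]; the set is empty only if A = 0. *)
Definition opnormA (R : realType) (H : completeNormedModType R[i])
    (dot : {dot H for conjC}) (A S : H -> H) : R :=
  sup [set seminormA dot A (S x) | x in [set x | seminormA dot A x = 1]].

Definition numradA (R : realType) (H : completeNormedModType R[i])
    (dot : {dot H for conjC}) (A S : H -> H) : R :=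
  sup [set complex.Re `|dotA dot A (S x) x| |
        x in [set x | seminormA dot A x = 1]].

(* Main.v *)
(* If <Tx, y>_A = <x, T'y>_A and |x|_A = 1, Buzano's inequality for Tx and T'x
   gives 2 |<Tx, x>_A|^2 <= |<T^2 x, x>_A| + |Tx|_A |T'x|_A, where AM-GM bounds
   the last product by (|Tx|_A^2 + |T'x|_A^2) / 2.  Adding alpha times this and
   beta times |<Tx, x>_A|^2 <= |Tx|_A^2, the quadratic terms become
   <Sx, x>_A for S = (alpha/4 + beta) T'T + (alpha/4) TT'.
   The A-adjoint pair (T, T^sharp) comes from the projection theorem, through
   Riesz representation for T^* and the splitting along N(A) for A^dagger.
   The suprema involved must be finite: W T is A-symmetric when A W = T^* A,
   so a norm-bounded W T is A-bounded by log-convexity of |(W T)^k x|_A in k,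
   and then |Tx|_A^2 = <x, W T x>_A. *)

Require Import Defs.
From HB Require Import structures.
From mathcomp Require Import all_boot all_order all_algebra.
From mathcomp Require Import all_classical all_reals all_analysis.
From mathcomp Require Import ring lra.

Set Implicit Arguments.
Unset Strict Implicit.
Unset Printing Implicit Defensive.

Import Order.TTheory GRing.Theory Num.Theory Num.Def.
Import numFieldNormedType.Exports.

Local Open Scope classical_set_scope.
Local Open Scope ring_scope.
Local Open Scope complex_scope.

(** * Semi-inner products: Cauchy-Schwarz, the parallelogram law and Buzano's inequality *)

Section SemiInnerProduct.
Variables (R : realType) (H : lmodType R[i]).
Implicit Types (phi : H -> H -> R[i]) (x y z : H).

(** Nonzero vectors with [phi x x = 0] are allowed, so that [dot] and [dotA dot A] are both
    instances. *)
Definition semi_inner phi : Prop :=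
  [/\ forall a x y z, phi (a *: x + y) z = a * phi x z + phi y z,
      forall x y, phi y x = (phi x y)^*%C
    & forall x, 0 <= phi x x].

Definition snorm phi x : R := Num.sqrt (complex.Re (phi x x)).

Variables (phi : H -> H -> R[i]) (hphi : semi_inner phi).

Lemma semi_innerDl x y z : phi (x + y) z = phi x z + phi y z.
Proof. by case: hphi => L _ _; rewrite -[x]scale1r L mul1r scale1r. Qed.

Lemma semi_inner0l z : phi 0 z = 0.
Proof. by apply: (addrI (phi 0 z)); rewrite -semi_innerDl !addr0. Qed.

Lemma semi_innerZl a x z : phi (a *: x) z = a * phi x z.
Proof. by case: hphi => L _ _; rewrite -[a *: x]addr0 L semi_inner0l addr0. Qed.

Lemma semi_innerC x y : phi y x = (phi x y)^*%C.
Proof. by case: hphi. Qed.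

Lemma semi_innerNl x z : phi (- x) z = - phi x z.
Proof. by rewrite -scaleN1r semi_innerZl mulN1r. Qed.

Lemma semi_innerBl x y z : phi (x - y) z = phi x z - phi y z.
Proof. by rewrite semi_innerDl semi_innerNl. Qed.

Lemma semi_innerDr x y z : phi z (x + y) = phi z x + phi z y.
Proof. by rewrite [LHS]semi_innerC semi_innerDl rmorphD/= -!semi_innerC. Qed.

Lemma semi_innerBr x y z : phi z (x - y) = phi z x - phi z y.
Proof. by rewrite [LHS]semi_innerC semi_innerBl rmorphB/= -!semi_innerC. Qed.

Lemma semi_innerZr a x z : phi z (a *: x) = a^*%C * phi z x.
Proof. by rewrite [LHS]semi_innerC semi_innerZl rmorphM/= -semi_innerC. Qed.

Lemma snorm_ge0 x : 0 <= snorm phi x.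
Proof. exact: sqrtr_ge0. Qed.

Lemma semi_inner_diag x : phi x x = (snorm phi x ^+ 2)%:C.
Proof.
case: hphi => _ _ /(_ x); rewrite /snorm lecE /=.
by case: (phi x x) => a b /= /andP[/eqP -> a0]; rewrite sqr_sqrtr.
Qed.

Lemma snorm_sqr x : snorm phi x ^+ 2 = complex.Re (phi x x).
Proof. by rewrite semi_inner_diag. Qed.

Lemma Re_norm_ge0 (z : R[i]) : 0 <= complex.Re `|z|.
Proof. by rewrite normc_def /= sqrtr_ge0. Qed.

Lemma Re_normE (z : R[i]) : (complex.Re `|z|)%:C = `|z|.
Proof. by rewrite normc_def. Qed.

Lemma Re_le_norm (z : R[i]) : complex.Re z <= complex.Re `|z|.
Proof. by apply: le_trans (ler_norm _) _; rewrite -lecR Re_normE normc_ge_Re. Qed.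

Lemma Re_normM (z w : R[i]) :
  complex.Re `|z * w| = complex.Re `|z| * complex.Re `|w|.
Proof. by apply: complexI; rewrite rmorphM /= !Re_normE normrM. Qed.

Lemma Re_normD (z w : R[i]) :
  complex.Re `|z + w| <= complex.Re `|z| + complex.Re `|w|.
Proof. by rewrite -lecR rmorphD /= !Re_normE ler_normD. Qed.

Lemma sqr_Re_norm (z : R[i]) :
  complex.Re `|z| ^+ 2 = complex.Re z ^+ 2 + complex.Im z ^+ 2.
Proof. by rewrite normc_def /= sqr_sqrtr ?addr_ge0 ?sqr_ge0. Qed.

(** The factor [phi x y] in the coefficient makes the cross terms real, so a real parameter [t]
    suffices both for Cauchy-Schwarz and for orthogonality of the projection. *)
Lemma snorm_subZ_sqr x y (t : R) :
  snorm phi (x - (t%:C * phi x y) *: y) ^+ 2 =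
  snorm phi x ^+ 2 - 2 * t * complex.Re `|phi x y| ^+ 2
  + t ^+ 2 * complex.Re `|phi x y| ^+ 2 * snorm phi y ^+ 2.
Proof.
rewrite [LHS]snorm_sqr.
rewrite semi_innerBl !semi_innerBr !semi_innerZl !semi_innerZr (semi_innerC x y).
by rewrite !semi_inner_diag !sqr_Re_norm; case: (phi x y) => a b /=; ring.
Qed.

(** For [Y > 0] the minimum over [t] is at [1 / Y]. For [Y = 0] the expression is affine in [t] and
    stays nonnegative only if [C = 0]. *)
Lemma quadratic_ge0 (X Y C : R) : 0 <= X -> 0 <= Y -> 0 <= C ->
  (forall t, 0 <= X - 2 * t * C + t ^+ 2 * C * Y) -> C <= X * Y.
Proof.
move=> X0 Y0 C0 key.
have [Y_eq0|Yn0] := eqVneq Y 0.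
  rewrite Y_eq0 mulr0 leNgt; apply/negP => Cgt0.
  (* At this [t] the value is [- X - 2 < 0]. *)
  have := key ((X + 1) / C); rewrite Y_eq0 mulr0 addr0.
  rewrite -mulrA divfK ?gt_eqF//; lra.
have Ygt0 : 0 < Y by rewrite lt_neqAle eq_sym Yn0.
have := key Y^-1.
have -> : X - 2 * Y^-1 * C + Y^-1 ^+ 2 * C * Y = X - C / Y by field.
by rewrite subr_ge0 ler_pdivrMr.
Qed.

Lemma semi_inner_CauchySchwarz x y :
  complex.Re `|phi x y| <= snorm phi x * snorm phi y.
Proof.
rewrite -(@ler_pXn2r _ 2%N) ?nnegrE ?mulr_ge0 ?snorm_ge0 ?Re_norm_ge0//.
rewrite exprMn; apply: quadratic_ge0; rewrite ?exprn_ge0 ?snorm_ge0 ?Re_norm_ge0// => t.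
by rewrite -snorm_subZ_sqr sqr_ge0.
Qed.

Lemma snormZ (a : R[i]) x : snorm phi (a *: x) = complex.Re `|a| * snorm phi x.
Proof.
apply/eqP; rewrite -(@eqrXn2 _ 2%N) ?mulr_ge0 ?snorm_ge0 ?Re_norm_ge0//.
rewrite exprMn snorm_sqr semi_innerZl semi_innerZr semi_inner_diag sqr_Re_norm.
by apply/eqP; case: a => a b /=; ring.
Qed.

Lemma snorm_parallelogram x y :
  snorm phi (x + y) ^+ 2 + snorm phi (x - y) ^+ 2 =
  2 * snorm phi x ^+ 2 + 2 * snorm phi y ^+ 2.
Proof.
rewrite !snorm_sqr !(semi_innerBl, semi_innerDl, semi_innerBr, semi_innerDr).
by case: (phi x x); case: (phi y y); case: (phi x y); case: (phi y x) => * /=; ring.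
Qed.

Lemma ler_snormD x y : snorm phi (x + y) <= snorm phi x + snorm phi y.
Proof.
rewrite -(@ler_pXn2r _ 2%N) ?nnegrE ?addr_ge0 ?snorm_ge0//.
have h3 := le_trans (Re_le_norm _) (semi_inner_CauchySchwarz x y).
rewrite sqrrD !snorm_sqr semi_innerDl !semi_innerDr (semi_innerC x y).
by move: h3; case: (phi x x); case: (phi y y); case: (phi x y) => *; cbn in *; lra.
Qed.

(* [2<a,x>x - a] is the reflection of [a] in the line of [x], hence has the
   same seminorm as [a]; apply Cauchy-Schwarz to it and [b]. *)
Lemma semi_inner_Buzano x a b : snorm phi x = 1 ->
  2 * (complex.Re `|phi a x| * complex.Re `|phi x b|) <=
  complex.Re `|phi a b| + snorm phi a * snorm phi b.
Proof.
move=> x1.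
have Ea : snorm phi ((2 * phi a x) *: x - a) = snorm phi a.
  apply/eqP; rewrite -(@eqrXn2 _ 2%N) ?snorm_ge0//; apply/eqP.
  rewrite !snorm_sqr semi_innerBl !semi_innerBr !semi_innerZl !semi_innerZr.
  rewrite (semi_innerC a x) (semi_inner_diag x) x1.
  by case: (phi a x) => u v; case: (phi a a) => * /=; ring.
have := semi_inner_CauchySchwarz ((2 * phi a x) *: x - a) b.
rewrite Ea semi_innerBl semi_innerZl -(lerD2l (complex.Re `|phi a b|)).
apply: le_trans; rewrite addrC.
apply: le_trans (Re_normD _ _).
by rewrite subrK !Re_normM -mulrA (_ : complex.Re `|2| = 2)// ger0_norm.
Qed.

End SemiInnerProduct.

(** * Projection theorem, Riesz representation, adjoint and Moore-Penrose inverse *)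

Section HilbertSpace.
Variables (R : realType) (H : completeNormedModType R[i]).
Variables (dot : {dot H for conjC}) (hdot : hilbert_norm dot).
Local Notation normH := (snorm dot).

Lemma dot_semi_inner : semi_inner dot.
Proof.
split => [a x y z|x y|x]; first by rewrite linearPl.
- by rewrite hermC expr0 mul1r.
- exact: dnorm_ge0.
Qed.
Let hd := dot_semi_inner.

Lemma hilbert_normE x : `|x| = (normH x)%:C.
Proof.
apply/eqP; rewrite -(@eqrXn2 _ 2%N) ?normr_ge0 ?ler0c ?snorm_ge0//.
by rewrite hdot (semi_inner_diag hd) rmorphXn.
Qed.

Lemma snorm_dot_eq0 x : normH x = 0 -> x = 0.
Proof. by move=> x0; apply/normr0_eq0; rewrite hilbert_normE x0. Qed.

Lemma dot_eq0 x : dot x x = 0 -> x = 0.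
Proof.
by move=> x0; apply/snorm_dot_eq0; rewrite /snorm x0 sqrtr0.
Qed.

(** Closure under midpoints makes every minimizing sequence Cauchy, by the parallelogram law; its
    limit is the closest point. *)
Lemma closest_point (N : set H) x : closed N -> N !=set0 ->
    (forall y z, N y -> N z -> N (2^-1 *: (y + z))) ->
  exists2 p, N p & forall z, N z -> normH (x - p) <= normH (x - z).
Proof.
move=> Ncl [z0 Nz0] Nmid.
pose E := [set normH (x - z) ^+ 2 | z in N].
have lbE : has_inf E.
  split; first by exists (normH (x - z0) ^+ 2), z0.
  by exists 0 => _ [z _ <-]; exact: sqr_ge0.
have infE z : N z -> inf E <= normH (x - z) ^+ 2.
  by move=> Nz; apply: ge_inf => //; [case: lbE | exists z].
have /choice[u uP] : forall k : nat, exists z,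
    N z /\ normH (x - z) ^+ 2 < inf E + k.+1%:R^-1.
  move=> k; have kgt0 : 0 < k.+1%:R^-1 :> R by rewrite invr_gt0.
  by have [_ [z Nz <-] zlt] := inf_adherent kgt0 lbE; exists z.
(* The midpoint of [u n] and [u m] lies in [N], so its squared distance to [x] is at least [inf E];
   the parallelogram law leaves [4 (inf E + e) - 4 inf E]. *)
have u_close (e : R) n m : n.+1%:R^-1 < e -> m.+1%:R^-1 < e ->
    normH (u n - u m) ^+ 2 <= 4 * e.
  move=> ne me; have [Nn un] := uP n; have [Nm um] := uP m.
  have := snorm_parallelogram hd (x - u m) (x - u n).
  have -> : x - u m - (x - u n) = u n - u m by rewrite opprB addrC subrKA.
  have -> : x - u m + (x - u n) = 2 *: (x - 2^-1 *: (u n + u m)).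
    rewrite scalerBr scalerA mulfV ?pnatr_eq0// scale1r scaler_nat.
    by rewrite mulr2n addrACA -opprD (addrC (u m)).
  rewrite (snormZ hd) exprMn ger0_norm// -[complex.Re 2]/(1 + 1 : R).
  have := infE _ (Nmid _ _ Nn Nm).
  move: (n.+1%:R^-1) (m.+1%:R^-1) ne me un um => a b ne me un um; lra.
have u_cvg : cvg (u @ \oo).
  apply/cauchy_cvgP/cauchy_ballP => e e0; rewrite near_map2.
  (* Radii of balls are elements of [R[i]]; a positive one is real. *)
  have [e1 e1E] : exists e1 : R, e = e1%:C.
    by exists (complex.Re e); rewrite RRe_real// gtr0_real.
  rewrite e1E ltcR in e0 *.
  have e2 : 0 < e1 ^+ 2 / 8 by rewrite divr_gt0// exprn_gt0.
  near=> n m.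
  rewrite -ball_normE /= hilbert_normE ltcR.
  rewrite -(@ltr_pXn2r _ 2%N) ?nnegrE ?snorm_ge0 ?(ltW e0)//.
  apply: (@le_lt_trans _ _ (4 * (e1 ^+ 2 / 8))); last by nra.
  apply: u_close.
  - by near: n; exact: (near_infty_natSinv_lt (PosNum e2)).
  - by near: m; exact: (near_infty_natSinv_lt (PosNum e2)).
exists (lim (u @ \oo)).
  by apply: (closed_cvg N Ncl _ _ u_cvg); near=> n; case: (uP n).
(* If [r < s], a term [u n] within [(s - r) / 2] of [p] is farther than [(s + r) / 2] from [x]. For
   large [n] this contradicts that its squared distance is below
   [r ^+ 2 + (((s + r) / 2) ^+ 2 - r ^+ 2)]. *)
move=> z Nz; set p := lim _; rewrite leNgt; apply/negP => zp.
set s := normH (x - p) in zp; set r := normH (x - z) in zp.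
have r0 : 0 <= r by exact: snorm_ge0.
have d0 : 0 < ((s + r) / 2) ^+ 2 - r ^+ 2.
  by rewrite subr_gt0 ltr_pXn2r ?nnegrE//; lra.
have e0 : 0 < ((s - r) / 2)%:C by rewrite ltcR; lra.
have [n [pn nd]] : exists n, `|p - u n| < ((s - r) / 2)%:C /\
    n.+1%:R^-1 < ((s + r) / 2) ^+ 2 - r ^+ 2.
  near \oo => n; exists n; split.
  - by near: n; move/cvgrPdist_lt : u_cvg; exact.
  - by near: n; exact: (near_infty_natSinv_lt (PosNum d0)).
rewrite distrC hilbert_normE ltcR in pn.
have := ler_snormD hd (x - u n) (u n - p); rewrite subrKA -/s => tri.
have xun : (s + r) / 2 < normH (x - u n) by lra.
have := infE _ Nz; have [_] := uP n; rewrite -/r.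
have : ((s + r) / 2) ^+ 2 < normH (x - u n) ^+ 2.
  by rewrite ltr_pXn2r ?nnegrE ?snorm_ge0//; lra.
move: (n.+1%:R^-1) nd => a nd; lra.
Unshelve. all: by end_near.
Qed.

(** Comparing the closest point [p] with [p + t <x - p, z> z] gives a quadratic in [t] with constant
    term 0, whence [|<x - p, z>|^2 <= 0]. *)
Lemma orthogonal_projection (N : set H) x : closed N -> N 0 ->
    (forall a y z, N y -> N z -> N (a *: y + z)) ->
  exists2 p, N p & forall z, N z -> dot (x - p) z = 0.
Proof.
move=> Ncl N0 Nlin.
have [||p Np pmin] := @closest_point N x Ncl.
- by exists 0.
- move=> y z Ny Nz; rewrite scalerDr; apply: (Nlin) => //.
  by rewrite -[_ *: z]addr0; exact: (Nlin).
exists p => // z Nz.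
suff C0 : complex.Re `|dot (x - p) z| ^+ 2 <= 0.
  apply/normr0_eq0; rewrite -Re_normE.
  by move: C0; rewrite real_exprn_even_le0 ?num_real//= => /eqP ->.
rewrite -(mul0r (normH z ^+ 2)); apply: quadratic_ge0; rewrite ?sqr_ge0// => t.
have := pmin _ (Nlin (t%:C * dot (x - p) z) _ _ Nz Np).
rewrite opprD addrCA addrA (addrC _ x) -addrA addrCA addrC.
rewrite -(@ler_pXn2r _ 2%N) ?nnegrE ?snorm_ge0//.
rewrite (snorm_subZ_sqr hd); lra.
Qed.

(** If [f p] were nonzero, a kernel point [z] close to [p] would give
    [|f p| = |f (p - z)| < |f p|]. *)
Lemma ker_closed (V : normedZmodType R[i]) (f : {additive H -> V}) (M : R) :
  (forall x, `|f x| <= M%:C * `|x|) -> closed (f @^-1` [set 0]).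
Proof.
move=> fM p pcl; apply: contrapT => /eqP fp0.
pose K := (`|M| + 1)%:C; have K0 : 0 < K by rewrite ltcR ltr_wpDl.
have e0 : 0 < `|f p| / K by rewrite divr_gt0 ?normr_gt0.
have [z [/= fz0]] := pcl _ (nbhsx_ballx p _ e0).
rewrite -ball_normE /= ltr_pdivlMr// => pz.
suff : `|f p| < `|f p| by rewrite ltxx.
apply: le_lt_trans pz.
rewrite -[f p]subr0 -fz0 -raddfB; apply: le_trans (fM _) _.
rewrite mulrC ler_wpM2l// lecR (le_trans (ler_norm M))// lerDl; exact: ler01.
Qed.


Lemma dot_CauchySchwarz x y : `|dot x y| <= `|x| * `|y|.
Proof.
rewrite !hilbert_normE -rmorphM -Re_normE lecR.
exact: semi_inner_CauchySchwarz.
Qed.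

(** For [f] nonzero the representing vector is a multiple of some [w] orthogonal to the kernel:
    [f w *: x - f x *: w] lies in the kernel, and pairing it with [w] determines [f x]. *)
Lemma Riesz_representation (f : {scalar H}) (M : R) :
  (forall x, `|f x| <= M%:C * `|x|) -> exists z, forall x, f x = dot x z.
Proof.
move=> fM.
have [f0|/existsNP[x0 /eqP fx0]] := pselect (forall x, f x = 0).
  by exists 0 => x; rewrite f0 linear0r.
have [||p fp0 porth] := @orthogonal_projection _ x0 (ker_closed fM).
- exact: linear0.
- by move=> a y z /= fy fz; rewrite linearP /= fy fz mulr0 addr0.
set w := x0 - p in porth.
have fw : f w = f x0 by rewrite /w linearB /= fp0 subr0.
have ww0 : dot w w != 0.
  by apply: contra fx0 => /eqP/dot_eq0 w0; rewrite -fw w0 linear0.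
exists ((f w / dot w w)^* *: w) => x.
rewrite (semi_innerZr hd) conjcK.
have : dot w (f w *: x - f x *: w) = 0.
  by apply: porth => /=; rewrite raddfB /= !(linearZ_LR f) /= mulrC subrr.
rewrite (semi_innerC hd) => /(congr1 (@conjc R)); rewrite conjcK conjc0.
rewrite (semi_innerBl hd) !(semi_innerZl hd) => /eqP; rewrite subr_eq0 => /eqP e.
by rewrite mulrAC e mulfK.
Qed.

(** Riesz representation of [x |-> <T x, y>] shows that the choice in [adjoint_op] never falls back
    on its default. *)
Lemma adjoint_opP (T : {linear H -> H}) x y : bounded_op T ->
  dot (T x) y = dot x (adjoint_op dot T y).
Proof.
move=> [M TM]; rewrite /adjoint_op; case: xgetP => [z _ /(_ x)//|].
have [|z zP /(_ z)] := @Riesz_representation (applyr dot y \o T) (M * normH y).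
  move=> u /=; apply: le_trans (dot_CauchySchwarz _ _) _.
  rewrite (hilbert_normE y) rmorphM mulrAC ler_wpM2r// ler0c; exact: snorm_ge0.
by case=> u; exact: zP.
Qed.

(** For a chosen [z], [A x - A z] is both in the range of [A] and orthogonal to it, hence 0. A
    choice exists: subtract from [x] its projection on the kernel of [A]. *)
Lemma mp_inverseP (A : {linear H -> H}) x : bounded_op A ->
  A (mp_inverse dot A (A x)) = A x.
Proof.
move=> [M AM]; rewrite /mp_inverse; case: xgetP => [z _ [_ zP]|].
  apply/esym/eqP; rewrite -subr_eq0; apply/eqP/dot_eq0.
  by rewrite -[X in dot _ X]linearB; apply: zP; exists (x - z).
have [||p Ap0 porth /(_ (x - p))] := @orthogonal_projection _ x (ker_closed AM).
- exact: linear0.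
- by move=> a y z /= Ay Az; rewrite linearP Ay Az scaler0 addr0.
case; split => // z _.
by rewrite linearB /= Ap0 subr0 subrr linear0l.
Qed.

(** * Positive operators and the form [dotA] *)

Section PositiveOperator.
Variables (A : {linear H -> H}) (hA : positive_op dot A).
Local Notation phi := (dotA dot A).

(** Hermitian symmetry comes by polarization: [<A (x + a y), x + a y>] is real, and [a = 1] and
    [a = i] compare the imaginary and the real parts of [<A x, y>] and [<A y, x>]. *)
Lemma dotA_semi_inner : semi_inner phi.
Proof.
have Im0 (x : H) : complex.Im (dot (A x) x) = 0.
  by have := hA x; rewrite lecE => /andP[/eqP].
have polar (a : R[i]) (x y : H) :
    complex.Im (a^*%C * dot (A x) y + a * dot (A y) x) = 0.
  have := Im0 (x + a *: y); rewrite (raddfD A) /= (linearZ_LR A) /=.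
  rewrite !(semi_innerDl hd) !(semi_innerDr hd) !(semi_innerZl hd).
  rewrite !(semi_innerZr hd); move: (Im0 x) (Im0 y).
  case: (dot (A x) x) (dot (A y) y) (dot (A x) y) (dot (A y) x) =>
    [? ?] [? ?] [? ?] [? ?]; case: a => a b /= -> -> <-; ring.
split => [a x y z|x y|]; last exact: hA.
  by rewrite /dotA linearP linearPl.
rewrite /dotA; move: (polar 1 x y) (polar 'i%C x y).
case: (dot (A x) y) (dot (A y) x) => [? ?] [? ?] /= e1 e2.
by apply/eqP; rewrite eq_complex /=; apply/andP; split; apply/eqP; lra.
Qed.

Lemma positive_op_sym x y : dot (A x) y = dot x (A y).
Proof.
have := semi_innerC dotA_semi_inner y x; rewrite /dotA => ->.
by rewrite -(semi_innerC hd).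
Qed.

End PositiveOperator.

End HilbertSpace.

(** * Adjoint pairs for a semi-inner product: seminorm bounds and the numerical radius estimate *)

Section AdjointPair.
Variables (R : realType) (H : lmodType R[i]).
Variables (phi : H -> H -> R[i]) (hphi : semi_inner phi).
Local Notation normP := (snorm phi).

(* The sequence of seminorms of [iter k B x] is log-convex, so it grows at
   least like the k-th power of the ratio of its first two terms. *)
Lemma snorm_le_growth (B : H -> H) (C M : R) x : 0 <= C -> 0 <= M ->
  (forall y z, phi (B y) z = phi y (B z)) ->
  (forall k, normP (iter k B x) <= C * M ^+ k) ->
  normP (B x) <= M * normP x.
Proof.
move=> C0 M0 Bsym growth; pose a k := normP (iter k B x).
have a_ge0 k : 0 <= a k by exact: snorm_ge0.
(* Symmetry moves one [B] across: [|B^(k+1) x|^2 = <B^k x, B^(k+2) x>]. *)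
have a_convex k : a k.+1 ^+ 2 <= a k * a k.+2.
  rewrite /a (snorm_sqr hphi) iterS Bsym -!iterS.
  apply: le_trans (semi_inner_CauchySchwarz hphi _ _).
  exact: Re_le_norm.
rewrite -[normP (B x)]/(a 1%N) -[normP x]/(a 0%N) leNgt; apply/negP => lt.
have a0 : 0 < a 0%N.
  rewrite lt_neqAle a_ge0 andbT eq_sym; apply/negP => /eqP a0.
  move: lt (a_convex 0%N); rewrite a0 mulr0 mul0r => lt.
  by rewrite leNgt exprn_gt0.
pose L := a 1%N / a 0%N.
have ML : M < L by rewrite ltr_pdivlMr.
have L0 : 0 < L by exact: le_lt_trans ML.
have aL k : 0 < a k /\ L * a k <= a k.+1.
  elim: k => [|k [ak0 IH]]; first by rewrite /L divfK ?gt_eqF.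
  have akS0 : 0 < a k.+1 by apply: lt_le_trans IH; exact: mulr_gt0.
  split=> //; rewrite -(ler_pM2l ak0); apply: le_trans (a_convex k).
  by rewrite mulrCA expr2 mulrA ler_wpM2r// ltW.
have aLk k : L ^+ k * a 0%N <= a k.
  elim: k => [|k IH]; first by rewrite mul1r.
  apply: le_trans (proj2 (aL k)).
  by rewrite exprS -mulrA ler_wpM2l// ltW.
have q1 : `|M / L| < 1.
  by rewrite ger0_norm ?divr_ge0 ?(ltW L0)// ltr_pdivrMr// mul1r.
(* From [L^k a_0 <= a_k <= C M^k], the powers of [M / L < 1] cannot drop below this value; [C + 1]
   avoids division by zero. *)
have e0 : 0 < a 0%N / (C + 1) by rewrite divr_gt0// ltr_wpDl.
have [k qk] : exists k, (M / L) ^+ k < a 0%N / (C + 1).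
  have /cvgrPdist_lt/(_ _ e0) := cvg_expr q1.
  move=> near0; near \oo => k; exists k.
  apply: le_lt_trans (ler_norm _) _; rewrite -normrN -sub0r.
  by near: k.
have Lk0 : 0 < L ^+ k by exact: exprn_gt0.
have := le_trans (aLk k) (growth k).
rewrite mulrC -ler_pdivlMr// -mulrA -expr_div_n leNgt => /negP; apply.
apply: le_lt_trans (_ : (C + 1) * (M / L) ^+ k < _).
  by rewrite ler_wpM2r ?lerDl ?ler01 ?exprn_ge0 ?divr_ge0 ?(ltW L0).
by rewrite mulrC -ltr_pdivlMr// ltr_wpDl.
Unshelve. all: by end_near.
Qed.

(** [|T' x|^2 = <T (T' x), x> <= c |T' x| |x|], then cancel [|T' x|]. *)
Lemma snorm_adjoint_le (T T' : H -> H) (c : R) :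
  (forall x y, phi (T x) y = phi x (T' y)) ->
  (forall x, normP (T x) <= c * normP x) ->
  forall x, normP (T' x) <= c * normP x.
Proof.
move=> adj Tc x; have [->|T'x0] := eqVneq (normP (T' x)) 0.
  exact: le_trans (snorm_ge0 _ _) (Tc x).
have T'x_gt0 : 0 < normP (T' x) by rewrite lt_neqAle eq_sym T'x0 snorm_ge0.
rewrite -(ler_pM2l T'x_gt0) -expr2 (snorm_sqr hphi) -adj.
apply: le_trans (_ : normP (T (T' x)) * normP x <= _).
  apply: le_trans (semi_inner_CauchySchwarz hphi _ _).
  exact: Re_le_norm.
by rewrite mulrA (mulrC _ c) ler_wpM2r ?snorm_ge0.
Qed.

Lemma snorm_le_of_adjoint_comp (T T' : H -> H) (M : R) : 0 <= M ->
  (forall x y, phi (T x) y = phi x (T' y)) ->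
  (forall x, normP (T' (T x)) <= M * normP x) ->
  forall x, normP (T x) <= Num.sqrt M * normP x.
Proof.
move=> M0 adj BM x.
rewrite -(@ler_pXn2r _ 2%N) ?nnegrE ?mulr_ge0 ?snorm_ge0 ?sqrtr_ge0//.
rewrite exprMn (sqr_sqrtr M0) (snorm_sqr hphi) adj expr2 mulrCA.
apply: le_trans (_ : normP x * normP (T' (T x)) <= _).
  apply: le_trans (semi_inner_CauchySchwarz hphi _ _).
  exact: Re_le_norm.
by rewrite ler_wpM2l ?snorm_ge0.
Qed.

Lemma sqr_sup_le (E : set R) (r : R) : 0 <= r ->
  (forall e, E e -> 0 <= e /\ e ^+ 2 <= r) -> sup E ^+ 2 <= r.
Proof.
move=> r0 Er; have [->|En] := eqVneq E set0.
  by rewrite sup0 expr0n.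
move/set0P : En => En; have [e Ee] := En.
have supE : sup E <= Num.sqrt r.
  apply: ge_sup => // f Ef; have [f0 fr] := Er _ Ef.
  by rewrite -(ger0_norm f0) -sqrtr_sqr ler_wsqrtr.
have sup0 : 0 <= sup E.
  have [e0 _] := Er _ Ee; apply: le_trans e0 _; apply: ub_le_sup => //.
  exists (Num.sqrt r) => f Ef; have [f0 fr] := Er _ Ef.
  by rewrite -(ger0_norm f0) -sqrtr_sqr ler_wsqrtr.
by rewrite -(sqr_sqrtr r0) ler_pXn2r ?nnegrE ?sqrtr_ge0.
Qed.

(** An empty or unbounded set has [sup] equal to 0 by convention. *)
Lemma sup_ge0 (E : set R) : (forall e, E e -> 0 <= e) -> 0 <= sup E.
Proof.
move=> E0; have [[[e Ee] Eub]|/sup_out ->//] := pselect (has_sup E).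
by apply: le_trans (E0 _ Ee) _; exact: ub_le_sup.
Qed.

(** The estimate for one fixed pair of weights, proved at each unit vector. The constant [c] makes
    the suprema on the right finite. *)
Lemma numrad_sqr_le (T T' : H -> H) (c a b : R) : 0 <= c ->
  (forall x y, phi (T x) y = phi x (T' y)) ->
  (forall x, normP (T x) <= c * normP x) ->
  (forall x, normP (T' x) <= c * normP x) ->
  0 <= a -> 0 <= b -> 0 < a + b ->
  sup [set complex.Re `|phi (T x) x| | x in [set x | normP x = 1]] ^+ 2 <=
  (a + b)^-1 *
    (sup [set normP (((a / 4 + b)%:C *: (T' \o T) + (a / 4)%:C *: (T \o T')) x)
         | x in [set x | normP x = 1]] +
     a / 2 * sup [set complex.Re `|phi ((T \o T) x) x|
                 | x in [set x | normP x = 1]]).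
Proof.
move=> c0 adj Tc T'c a0 b0 ab0.
set S := _ *: (T' \o T) + _.
set O := (X in _ <= _ * (X + _)); set N := (X in _ <= _ * (_ + _ * X)).
have nT x : normP x = 1 -> normP (T x) <= c by move=> x1; rewrite -[c]mulr1 -x1.
have nT' x : normP x = 1 -> normP (T' x) <= c by move=> x1; rewrite -[c]mulr1 -x1.
have c1 : 0 <= a / 4 + b by lra.
have c2 : 0 <= a / 4 by lra.
have O0 : 0 <= O by apply: sup_ge0 => _ [x _ <-]; exact: snorm_ge0.
have N0 : 0 <= N by apply: sup_ge0 => _ [x _ <-]; exact: Re_norm_ge0.
apply: sqr_sup_le.
  rewrite mulr_ge0 ?invr_ge0 ?(ltW ab0)// addr_ge0// mulr_ge0//; lra.
move=> _ [x x1 <-]; have {}x1 : normP x = 1 := x1; split; first exact: Re_norm_ge0.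
(* A [sup] dominates its set only when the set is bounded above, so here and for [O] a bound in
   terms of [c] is exhibited. *)
have TT : complex.Re `|phi (T (T x)) x| <= N.
  apply: ub_le_sup; last by exists x.
  exists (c * c) => _ [y /= y1 <-].
  apply: le_trans (semi_inner_CauchySchwarz hphi _ _) _; rewrite y1 mulr1.
  by apply: le_trans (Tc _) _; rewrite ler_wpM2l// nT.
have SE y : S y = (a / 4 + b)%:C *: T' (T y) + (a / 4)%:C *: T (T' y) by [].
have nZ (k : R) y : 0 <= k -> normP (k%:C *: y) = k * normP y.
  by move=> k0; rewrite (snormZ hphi) ger0_norm// lecR.
have SO : normP (S x) <= O.
  apply: ub_le_sup; last by exists x.
  exists ((a / 4 + b) * (c * c) + a / 4 * (c * c)) => _ [y /= y1 <-].
  rewrite SE; apply: le_trans (ler_snormD hphi _ _) _; rewrite !nZ//.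
  apply: lerD; apply: ler_wpM2l => //.
    by apply: le_trans (T'c _) _; rewrite ler_wpM2l// nT.
  by apply: le_trans (Tc _) _; rewrite ler_wpM2l// nT'.
(* The left side is [<S x, x>], at most [|S x|] by Cauchy-Schwarz. *)
have Sx : (a / 4 + b) * normP (T x) ^+ 2 + a / 4 * normP (T' x) ^+ 2 <= O.
  apply: le_trans SO; have := semi_inner_CauchySchwarz hphi (S x) x.
  rewrite x1 mulr1; apply: le_trans.
  have -> : phi (S x) x =
      ((a / 4 + b) * normP (T x) ^+ 2 + a / 4 * normP (T' x) ^+ 2)%:C.
    rewrite SE (semi_innerDl hphi) !(semi_innerZl hphi) adj.
    rewrite (semi_innerC hphi x (T' (T x))) -adj !(semi_inner_diag hphi).
    by rewrite conjc_real -!rmorphM -rmorphD.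
  by rewrite ger0_norm// lecR addr_ge0// mulr_ge0// sqr_ge0.
have Buz := semi_inner_Buzano hphi (T x) (T' x) x1.
(* Turns [<x, T' x>] into [<T x, x>] and [<T x, T' x>] into [<T (T x), x>]. *)
rewrite -!adj in Buz.
have CS := semi_inner_CauchySchwarz hphi (T x) x; rewrite x1 mulr1 in CS.
rewrite mulrC ler_pdivlMr//.
move: (Re_norm_ge0 (phi (T x) x)) (snorm_ge0 phi (T x)) (snorm_ge0 phi (T' x)).
move: (complex.Re `|phi (T x) x|) (complex.Re `|phi (T (T x)) x|) TT Buz CS Sx.
move: (normP (T x)) (normP (T' x)) => t t' z n TT Buz CS Sx z0 t0 t'0.
have e1 : 2 * (a * (z * z)) <= a * (N + t * t') by rewrite mulrCA ler_wpM2l//; lra.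
have e2 : a * (t * t') <= a * ((t ^+ 2 + t' ^+ 2) / 2).
  by rewrite ler_wpM2l//; have := sqr_ge0 (t - t'); lra.
have e3 : b * z ^+ 2 <= b * t ^+ 2 by rewrite ler_wpM2l// ler_pXn2r.
lra.
Qed.

End AdjointPair.

(** * Boundedness with respect to the seminorm of [A] *)

Section ABoundedness.
Variables (R : realType) (H : completeNormedModType R[i]).
Variables (dot : {dot H for conjC}) (hdot : hilbert_norm dot).
Local Notation normH := (snorm dot).

Lemma bounded_op_snorm (T : {linear H -> H}) : bounded_op T ->
  exists2 M, 0 <= M & forall x, normH (T x) <= M * normH x.
Proof.
move=> [M TM]; exists `|M| => // x.
have := TM x; rewrite !(hilbert_normE hdot) -rmorphM lecR => h.
by apply: le_trans h _; rewrite ler_wpM2r ?snorm_ge0 ?ler_norm.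
Qed.

(** With norm bounds [a], [t], [w], [|(W T)^k x|_A <= sqrt a |x| (w t)^k]. The factor in front
    involves the norm of [x], but the growth lemma retains only the ratio [w t]. *)
Lemma snorm_dotA_bounded (A T W : {linear H -> H}) :
  bounded_op A -> bounded_op T -> bounded_op W -> positive_op dot A ->
  (forall x y, dotA dot A (T x) y = dotA dot A x (W y)) ->
  exists2 c, 0 <= c &
    forall x, snorm (dotA dot A) (T x) <= c * snorm (dotA dot A) x.
Proof.
move=> /bounded_op_snorm[a a0 Aa] /bounded_op_snorm[t t0 Tt].
move=> /bounded_op_snorm[w w0 Ww] hA adj.
have hphi := dotA_semi_inner hA.
have nA_le x : snorm (dotA dot A) x <= Num.sqrt a * normH x.
  rewrite -(@ler_pXn2r _ 2%N) ?nnegrE ?mulr_ge0 ?snorm_ge0 ?sqrtr_ge0//.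
  rewrite exprMn (sqr_sqrtr a0) (snorm_sqr hphi) expr2 mulrA.
  apply: le_trans (_ : normH (A x) * normH x <= _).
    apply: le_trans (semi_inner_CauchySchwarz (dot_semi_inner dot) _ _).
    exact: Re_le_norm.
  by rewrite ler_wpM2r ?snorm_ge0.
have wt0 : 0 <= w * t by exact: mulr_ge0.
exists (Num.sqrt (w * t)); first exact: sqrtr_ge0.
apply: (snorm_le_of_adjoint_comp hphi wt0 adj) => x.
apply: (@snorm_le_growth _ _ _ hphi (W \o T) (Num.sqrt a * normH x)) => //=.
- by rewrite mulr_ge0 ?snorm_ge0 ?sqrtr_ge0.
- by move=> y z; rewrite (semi_innerC hphi z) -adj -(semi_innerC hphi) adj.
move=> k; apply: le_trans (nA_le _) _; rewrite -mulrA ler_wpM2l ?sqrtr_ge0//.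
elim: k => [|k IH] /=; first by rewrite expr0 mulr1.
apply: le_trans (Ww _) _; rewrite exprS mulrCA -mulrA ler_wpM2l//.
by apply: le_trans (Tt _) _; rewrite ler_wpM2l.
Qed.

End ABoundedness.

Theorem corollary3p24 (R : realType) (H : completeNormedModType R[i])
  (dot : {dot H for conjC}) (hdot : hilbert_norm dot)
  (hH : exists x : H, x <> 0)
  (A : {linear H -> H}) (hAb : bounded_op A) (hA : positive_op dot A)
  (T : {linear H -> H}) (hT : in_BA dot A T) :
  numradA dot A T ^+ 2 <=
  inf [set (ab.1 + ab.2)^-1 *
           (opnormA dot A
              ((ab.1 / 4 + ab.2)%:C *: (sharp dot A T \o T) +
               (ab.1 / 4)%:C *: (T \o sharp dot A T)) +
            ab.1 / 2 * numradA dot A (T \o T))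
      | ab in [set ab : R * R | [/\ 0 <= ab.1, 0 <= ab.2 & ab <> (0, 0)]]].
Proof.
have [hTb [W [hWb AW]]] := hT.
have hphi := dotA_semi_inner hA.
pose T' := sharp dot A T.
have AWx x : A (W x) = adjoint_op dot T (A x) by have := congr1 (@^~ x) AW.
(* [T^* A x = A (W x)] is in the range of [A], where [A A^dagger] is the identity. *)
have AT' x : A (T' x) = A (W x) by rewrite /T' /sharp /= -AWx (mp_inverseP hdot).
have adj x y : dotA dot A (T x) y = dotA dot A x (T' y).
  rewrite /dotA !(positive_op_sym hA) AT' AWx; exact: adjoint_opP.
(* [T'] is a bare function here; the bounded linear [W], with the same image under [A], yields the
   seminorm bound for [T], which then passes to [T']. *)
have adjW x y : dotA dot A (T x) y = dotA dot A x (W y).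
  by rewrite adj /dotA !(positive_op_sym hA) AT'.
have [c c0 Tc] := snorm_dotA_bounded hdot hAb hTb hWb hA adjW.
have T'c := snorm_adjoint_le hphi adj Tc.
(* A lower bound is below [inf] only for a nonempty set; the pair [(1, 0)] provides a member. *)
apply: lb_le_inf.
  exists (1^-1 * (opnormA dot A
    ((1 / 4 + 0)%:C *: (sharp dot A T \o T) +
    (1 / 4)%:C *: (T \o sharp dot A T)) + 1 / 2 * numradA dot A (T \o T))).
  exists (1, 0) => /=; last by rewrite addr0.
  by split=> // -[] /eqP; rewrite oner_eq0.
move=> _ [[a b] /= [a0 b0 ab] <-].
apply: (numrad_sqr_le hphi c0 adj Tc T'c a0 b0).
rewrite lt_neqAle eq_sym paddr_eq0// addr_ge0// andbT.
by apply/negP => /andP[/eqP ea /eqP eb]; apply: ab; rewrite ea eb.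
Qed.
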